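(* Let $(X,E)$ be an mq-space. Then $(D(X),\triangle_E,\nabla_E)$ is subdirectly irreducible but not simple if and only if exactly one of the following holds: (a) $\{x\in X: \overline{\max E(x)}^{\mathcal S}=X\}$ is a proper nonempty open subset of $X$; (b) there is $x\in X$ with $x\notin\overline{\max E(x)}^{\mathcal S}$ and $X=\overline{\max E(x)}^{\mathcal S}\cup\{x\}$.
   Context: Notation: $E(Z)=\{y:(x,y)\in E$ for some $x\in Z\}$, $E(x)=E(\{x\})$; in a poset $(Y]$, $[Y)$ are the generated down-/up-sets, $[x)=[\{x\})$; $\max Y$, $\min Y$ maximal/minimal elements. A Priestley space is a compact space with a partial order such that whenever $x\not\le y$ there is a clopen increasing $U$ with $x\in U$, $y\notin U$; $D(X)$ = clopen increasing subsets. A q-space is $(X,E)$ with $X$ Priestley and $E$ an equivalence relation with $E(U)\in D(X)$ for $U\in D(X)$ and closed classes; an mq-space additionally satisfies (mq1) $(x,y)\in E$, $y\le z$ imply some $w$ with $x\le w$, $(w,z)\in E$; (mq2) $(E(X\setminus V)]$ is clopen for $V\in D(X)$. On $D(X)$: $\nabla_E U=E(U)$, $\triangle_E U=X\setminus(E(X\setminus U)]$; this gives an m-lattice, whose congruences are lattice congruences compatible with $\triangle_E,\nabla_E$. A subset $Y$ is $id$-saturated if $\min E([y))\cup\max E(y)\subseteq Y$ for all $y\in Y$. $\mathcal C_{idS}(X)$ is the set of subsets that are closed (in the topology of $X$) and $id$-saturated; the complements of its members form a topology $\tau_{\mathcal S}$ on $X$, and $\overline{Y}^{\mathcal S}$ denotes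 the closure of $Y$ in $\tau_{\mathcal S}$, i.e. the intersection of all members of $\mathcal C_{idS}(X)$ containing $Y$. ''Open'' in (a) refers to the original topology of $X$. *)

(* Defs.v *)
From HB Require Import structures.
From mathcomp Require Import all_boot all_order.
From mathcomp Require Import boolp classical_sets topology.

Set Implicit Arguments.
Unset Strict Implicit.
Unset Printing Implicit Defensive.
Import Order.TTheory.

Local Open Scope order_scope.
Local Open Scope classical_set_scope.

(* The signature of m-lattices.  The bounds 0 and 1 are left out: constants
   play no role in the notion of congruence. *)
Record mAlgebra := MAlgebra {
  mcarrier :> Type;
  mmeet : mcarrier -> mcarrier -> mcarrier;
  mjoin : mcarrier -> mcarrier -> mcarrier;
  mtriangle : mcarrier -> mcarrier;
  mnabla : mcarrier -> mcarrier }.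

Section Congruences.
Variable A : mAlgebra.
Implicit Types theta : A -> A -> Prop.

Record congruence theta : Prop := Congruence {
  cong_equiv : RelationClasses.Equivalence theta;
  cong_meet : forall a b c d,
    theta a b -> theta c d -> theta (mmeet a c) (mmeet b d);
  cong_join : forall a b c d,
    theta a b -> theta c d -> theta (mjoin a c) (mjoin b d);
  cong_triangle : forall a b, theta a b -> theta (mtriangle a) (mtriangle b);
  cong_nabla : forall a b, theta a b -> theta (mnabla a) (mnabla b) }.

Definition non_identity theta := exists a b, theta a b /\ a <> b.

(* There is a least congruence distinct from the identity (a monolith).
   One-element algebras are neither subdirectly irreducible nor simple. *)
Definition subdirectly_irreducible := exists theta,
  [/\ congruence theta, non_identity theta
    & forall theta', congruence theta' -> non_identity theta' ->
        forall a b, theta a b -> theta' a b].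

Definition simple_algebra :=
  (exists a b : A, a <> b) /\
  forall theta, congruence theta ->
    (forall a b, theta a b <-> a = b) \/ (forall a b, theta a b).

End Congruences.

Section OrderedSpaces.
Variables (d : Order.disp_t) (X : POrderedTopological.type d).
Implicit Types (U V Y Z : set X) (E : X -> X -> Prop).

Definition increasing U := forall x y, U x -> x <= y -> U y.

Definition upset Y : set X := [set x | exists y, Y y /\ y <= x].

Definition maxs Y : set X := [set x | Y x /\ forall y, Y y -> x <= y -> y = x].
Definition mins Y : set X := [set x | Y x /\ forall y, Y y -> y <= x -> y = x].

Definition clopen_increasing : set (set X) :=
  [set U | clopen U /\ increasing U].

Record priestley : Prop := Priestley {
  priestley_compact : compact [set: X];
  priestley_separation : forall x y, ~ x <= y ->
    exists U, [/\ clopen_increasing U, U x & ~ U y] }.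

Definition rel_image E Z : set X := [set y | exists x, Z x /\ E x y].

Record q_space E : Prop := QSpace {
  q_priestley : priestley;
  q_equiv : RelationClasses.Equivalence E;
  q_image : forall U, clopen_increasing U -> clopen_increasing (rel_image E U);
  q_class : forall x, closed (rel_image E [set x]) }.

Record mq_space E : Prop := MQSpace {
  mq_q_space :> q_space E;
  mq1 : forall x y z, E x y -> y <= z -> exists w, x <= w /\ E w z;
  mq2 : forall V, clopen_increasing V -> clopen (down (rel_image E (~` V))) }.

Lemma clopen_increasingI U V : clopen_increasing U -> clopen_increasing V ->
  clopen_increasing (U `&` V).
Proof.
move=> [cU iU] [cV iV]; split; first exact: clopenI.
by move=> x y [Ux Vx] xy; split; [exact: iU xy|exact: iV xy].
Qed.

Lemma clopen_increasingU U V : clopen_increasing U -> clopen_increasing V ->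
  clopen_increasing (U `|` V).
Proof.
move=> [cU iU] [cV iV]; split; first exact: clopenU.
by move=> x y [Ux|Vx] xy; [left; exact: iU xy|right; exact: iV xy].
Qed.

Lemma clopen_increasing_triangle E U : mq_space E -> clopen_increasing U ->
  clopen_increasing (~` down (rel_image E (~` U))).
Proof.
move=> mqE DU; split; first exact/clopenC/(mq2 mqE).
move=> x y nx xy [z [Ez yz]]; apply: nx; exists z.
by split=> //; exact: le_trans yz.
Qed.

(* The set D(X), coerced to a type. *)
Definition DX : Type := clopen_increasing.

Definition mkDX U (DU : clopen_increasing U) : DX := exist _ U (mem_set DU).

Lemma DXP (U : DX) : clopen_increasing (\val U).
Proof. exact: set_mem (valP U). Qed.

Definition dual_algebra E (mqE : mq_space E) : mAlgebra := {|
  mcarrier := DX;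
  mmeet := fun U V : DX => mkDX (clopen_increasingI (DXP U) (DXP V));
  mjoin := fun U V : DX => mkDX (clopen_increasingU (DXP U) (DXP V));
  mtriangle := fun U : DX => mkDX (clopen_increasing_triangle mqE (DXP U));
  mnabla := fun U : DX => mkDX (q_image mqE (DXP U)) |}.

Definition id_saturated E Y := forall y, Y y ->
  mins (rel_image E (upset [set y])) `|` maxs (rel_image E [set y]) `<=` Y.

Definition closed_id_saturated E : set (set X) :=
  [set Y | closed Y /\ id_saturated E Y].

(* The closure in the topology whose closed sets are the members of
   closed_id_saturated E. *)
Definition S_closure E Y : set X := smallest (closed_id_saturated E) Y.

Definition S_closure_max E (x : X) : set X :=
  S_closure E (maxs (rel_image E [set x])).

End OrderedSpaces.

(* Main.v *)
(** Congruences of D(X) correspond, with inclusion reversed, to closed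
id-saturated subsets Y of X: Y gives the relation "U and V agree on Y".  So D(X)
is subdirectly irreducible but not simple iff X has a greatest proper closed
id-saturated subset M and M is nonempty.  Write C(x) for the S-closure of
max E(x).  By (mq1), E([x)) depends only on the class of x, so
min E([x)) is contained in C(x), and both C(x) and C(x) together with x are
closed and id-saturated.  Given M, if every x outside M has C(x) = X, then the
complement of M is the set in (a); otherwise some x outside M has C(x)
contained in M, and C(x) together with x, not being contained in M, is X,
which is (b).  Conversely M is the complement of the set in (a), respectively
C(x) in (b), and (a) and (b) exclude each other. *)

Require Import Defs.
From mathcomp Require Import all_boot all_order.
From mathcomp Require Import boolp classical_sets topology.
Local Open Scope classical_set_scope.

Set Implicit Arguments.
Unset Strict Implicit.
Unset Printing Implicit Defensive.
Import Order.TTheory.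

Lemma closed_setD (T : topologicalType) (A B : set T) :
  closed A -> open B -> closed (A `\` B).
Proof. by move=> cA oB; rewrite setDE; apply: closedI => //; exact: open_closedC. Qed.

Lemma open_setD (T : topologicalType) (A B : set T) :
  open A -> closed B -> open (A `\` B).
Proof. by move=> oA cB; rewrite setDE; apply: openI => //; exact: closed_openC. Qed.

(** * Compactness for directed families of closed sets *)

Section Compactness.
Variable T : topologicalType.
Hypothesis cT : compact [set: T].

Lemma compact_directed_bigcap I (D : set I) (f : I -> set T) :
  D !=set0 -> (forall i, D i -> closed (f i)) ->
  (forall i j, D i -> D j -> exists2 k, D k & f k `<=` f i `&` f j) ->
  (forall i, D i -> f i !=set0) -> \bigcap_(i in D) f i !=set0.
Proof.
move=> D0 fcl fdir f0.
have FF : Filter (filter_from D f) by exact: filter_from_filter.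
have PF : ProperFilter (filter_from D f) by exact: filter_from_proper.
have [|x [_ clx]] := cT PF; first by have [i Di] := D0; exists i.
by exists x => i Di; apply: fcl => // B xB; apply: clx => //; exists i.
Qed.

(** Contrapositive form, used to turn a separation chosen point by point into a single uniform
    one. *)
Lemma compact_directed_empty I (D : set I) (f : I -> set T) :
  D !=set0 -> (forall i, D i -> closed (f i)) ->
  (forall i j, D i -> D j -> exists2 k, D k & f k `<=` f i `&` f j) ->
  (forall x, exists2 i, D i & ~ f i x) -> exists2 i, D i & forall x, ~ f i x.
Proof.
move=> D0 fcl fdir f0; apply: contrapT => nex.
have [i Di|x fx] := compact_directed_bigcap D0 fcl fdir.
  apply: contrapT => fi0; apply: nex; exists i => // x fx.
  by apply: fi0; exists x.
by have [i Di] := f0 x; apply; exact: fx.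
Qed.

(** Zorn's lemma on the points of [K] above [x]: the closed sets of points of [K] above the members
    of a chain meet by compactness, which gives an upper bound. The order is abstract so as to serve
    both [<=] and its converse. *)
Lemma closed_maximal (R : rel T) (K : set T) (x : T) :
  reflexive R -> transitive R -> antisymmetric R ->
  (forall a, closed [set y | R a y]) -> closed K -> K x ->
  exists m, [/\ K m, R x m & forall y, K y -> R m y -> y = m].
Proof.
move=> Rr Rt Ra Rcl Kcl Kx.
pose S := {y : T | K y /\ R x y}.
pose R' : rel S := fun u v => R (sval u) (sval v).
have [||A Atot|[m [Km xm]] mmax] := @ZL_preorder S (exist _ x (conj Kx (Rr x))) R'.
- by move=> u; exact: Rr.
- by move=> u v w; exact: Rt.
- have [->|/set0P A0] := eqVneq A set0.
    by exists (exist _ x (conj Kx (Rr x))).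
  pose f (u : S) := K `&` [set y | R (sval u) y].
  have [|u v Au Av|u Au|y fy] := @compact_directed_bigcap S A f A0.
  + by move=> u _; apply: closedI.
  + have [uv|vu] := Atot _ _ Au Av.
      by exists v => // z [Kz vz]; split; split=> //; exact: Rt vz.
    by exists u => // z [Kz uz]; split; split=> //; exact: Rt uz.
  + by exists (sval u); split=> /=; [case: (svalP u)|exact: Rr].
  have [u0 Au0] := A0; have [Ky u0y] := fy _ Au0.
  have xy : R x y by apply: Rt u0y; case: (svalP u0).
  by exists (exist _ y (conj Ky xy)) => s /fy[].
exists m; split=> // y Ky my.
have xy : R x y by exact: Rt my.
by apply: Ra; rewrite my andbT; exact: (mmax (exist _ y (conj Ky xy))).
Qed.

End Compactness.

(** * Separation of points from closed sets in Priestley spaces *)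

Section PriestleySpaces.
Variables (d : Order.disp_t) (X : POrderedTopological.type d).
Hypothesis pX : priestley X.
Implicit Types (x y z : X) (U V W Y Z K : set X).
Local Open Scope order_scope.
Local Open Scope classical_set_scope.

Lemma closed_upset1 x : closed (upset [set x]).
Proof.
have -> : upset [set x] = \bigcap_(U in [set U | clopen_increasing U /\ U x]) U.
  apply/seteqP; split=> [z [_ [-> xz]] U [[_ iU] Ux]|z zU]; first exact: iU xz.
  apply: contrapT => xz.
  have [|U [DU Ux]] := priestley_separation pX (x := x) (y := z).
    by move=> xz'; apply: xz; exists x.
  by apply; exact: zU.
by apply: closed_bigI => U [[[]]].
Qed.

Lemma closed_down1 x : closed [set y | y <= x].
Proof.
have -> : [set y | y <= x] =
    \bigcap_(U in [set U | clopen_increasing U /\ ~ U x]) ~` U.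
  apply/seteqP; split=> [z zx U [[_ iU] nUx] Uz|z zU].
    by apply: nUx; exact: iU zx.
  apply: contrapT => /(priestley_separation pX)[U [DU Uz nUx]].
  by apply: (zU U).
by apply: closed_bigI => U [[[oU _] _] _]; exact: open_closedC.
Qed.

Lemma closed_le_above x : closed [set y | x <= y].
Proof.
suff -> : [set y | x <= y] = upset [set x] by exact: closed_upset1.
by apply/seteqP; split=> [z xz|z [_ [-> xz]]] //; exists x.
Qed.

Lemma closed_singleton x : closed [set x].
Proof.
suff -> : [set x] = [set y | x <= y] `&` [set y | y <= x].
  by apply: closedI; [exact: closed_le_above|exact: closed_down1].
apply/seteqP; split=> [z ->|z [/= xz zx]] /=; first by split=> /=.
by apply: le_anti; rewrite zx xz.
Qed.

Lemma closed_above_max K x : closed K -> K x -> exists2 m, maxs K m & x <= m.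
Proof.
move=> Kcl Kx.
have [|||m [Km xm mmax]] :=
    closed_maximal (priestley_compact pX) (R := <=%O) (lexx (T := X)) _ _ _ Kcl Kx.
- exact: le_trans.
- exact: le_anti.
- exact: closed_le_above.
by exists m => //; split.
Qed.

Lemma closed_below_min K x : closed K -> K x -> exists2 m, mins K m & m <= x.
Proof.
move=> Kcl Kx.
have [|||m [Km xm mmin]] :=
    closed_maximal (priestley_compact pX) (R := >=%O) (lexx (T := X)) _ _ _ Kcl Kx.
- by move=> a b c /= ba ac; exact: le_trans ba.
- by move=> a b /=; rewrite andbC; exact: le_anti.
- exact: closed_down1.
by exists m => //; split.
Qed.

Lemma clopen_increasingT : clopen_increasing [set: X].
Proof. by split=> //; split; [exact: openT|exact: closedT]. Qed.

Lemma clopen_increasing0 : clopen_increasing (set0 : set X).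
Proof. by split=> //; split; [exact: open0|exact: closed0]. Qed.

(** The traces on [K] of the clopen increasing sets around [x] form a directed closed family, and
    Priestley separation removes each point of [K] from one of them. Compactness makes one trace
    empty. *)
Lemma closed_disjoint_above K x : closed K -> (forall y, K y -> ~ x <= y) ->
  exists U, [/\ clopen_increasing U, U x & forall y, K y -> ~ U y].
Proof.
move=> Kcl Kx.
have [||U V|y|U [DU Ux] KU] := compact_directed_empty (priestley_compact pX)
    (D := [set U | clopen_increasing U /\ U x]) (f := fun U => K `&` U).
- by exists setT; split=> //; exact: clopen_increasingT.
- by move=> U [[[_ cU] _] _]; exact: closedI.
- move=> [DU Ux] [DV Vx]; exists (U `&` V); last by move=> y [Ky []].
  by split=> //; exact: clopen_increasingI.
- have [Ky|nKy] := pselect (K y); last first.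
    by exists setT => [|[]//]; split=> //; exact: clopen_increasingT.
  have [U [DU Ux nUy]] := priestley_separation pX (Kx _ Ky).
  by exists U => // -[].
by exists U; split=> // y Ky Uy; apply: (KU y).
Qed.

Lemma closed_disjoint_below K x : closed K -> (forall y, K y -> ~ y <= x) ->
  exists U, [/\ clopen_increasing U, ~ U x & K `<=` U].
Proof.
move=> Kcl Kx.
have [||U V|y|U [DU Ux] KU] := compact_directed_empty (priestley_compact pX)
    (D := [set U | clopen_increasing U /\ ~ U x]) (f := fun U => K `&` ~` U).
- by exists set0; split=> //; exact: clopen_increasing0.
- by move=> U [[[oU _] _] _]; apply: closedI => //; exact: open_closedC.
- move=> [DU Ux] [DV Vx]; exists (U `|` V).
    by split=> [|[]//]; exact: clopen_increasingU.
  by move=> y [Ky nUV]; split; split=> // ?; apply: nUV; [left|right].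
- have [Ky|nKy] := pselect (K y); last first.
    by exists set0 => [|[]//]; split=> //; exact: clopen_increasing0.
  have [U [DU Uy nUx]] := priestley_separation pX (Kx _ Ky).
  by exists U => // -[].
exists U; split=> // y Ky; apply: contrapT => nUy.
by apply: (KU y).
Qed.

(** The differences [U \ V] of clopen increasing sets form a base of the topology. Here [U] is
    chosen to miss the points of [K] below [x]; then no point of [K] in [U] is below [x], and [V]
    can absorb them all. *)
Lemma closed_separation K x : closed K -> ~ K x ->
  exists U V, [/\ clopen_increasing U, clopen_increasing V,
    U x, ~ V x & forall y, K y -> U y -> V y].
Proof.
move=> Kcl nKx.
have [||U [DU Ux KU]] := @closed_disjoint_above (K `&` [set y | y <= x]) x.
- by apply: closedI => //; exact: closed_down1.
- move=> y [Ky /= yx] xy; apply: nKx.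
  by suff -> : x = y by []; apply: le_anti; rewrite xy yx.
have [||V [DV Vx KV]] := @closed_disjoint_below (K `&` U) x.
- by apply: closedI => //; case: DU => -[].
- by move=> y [Ky Uy] yx; apply: (KU y).
by exists U, V; split=> // y Ky Uy; apply: KV.
Qed.

End PriestleySpaces.

(** * Classes of [E] and S-closures in an mq-space *)

Section MqSpaces.
Variables (d : Order.disp_t) (X : POrderedTopological.type d).
Variables (E : X -> X -> Prop) (mqE : mq_space E).
Implicit Types (x y z : X) (Y Z K : set X).
Local Open Scope order_scope.
Local Open Scope classical_set_scope.

Let pX : priestley X := q_priestley mqE.

Lemma E_refl x : E x x.
Proof. by have [r _ _] := q_equiv mqE; exact: r. Qed.

Lemma E_sym x y : E x y -> E y x.
Proof. by have [_ s _] := q_equiv mqE; exact: s. Qed.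

Lemma E_trans x y z : E x y -> E y z -> E x z.
Proof. by have [_ _ t] := q_equiv mqE; exact: t. Qed.

Lemma rel_image1E x y : rel_image E [set x] y <-> E x y.
Proof. by split=> [[_ [-> ]]|xy] //; exists x. Qed.

Lemma closed_class x : closed (rel_image E [set x]).
Proof. exact: (q_class mqE). Qed.

Lemma rel_image_upsetE x z :
  rel_image E (upset [set x]) z <-> exists w, x <= w /\ E w z.
Proof.
split=> [[w [[_ [-> xw]] wz]]|[w [xw wz]]]; exists w => //.
by split=> //; exists x.
Qed.

Lemma rel_image_upset_sub x y : E x y ->
  rel_image E (upset [set y]) `<=` rel_image E (upset [set x]).
Proof.
move=> xy z /rel_image_upsetE[w [yw wz]]; apply/rel_image_upsetE.
have [v [xv vw]] := mq1 mqE xy yw.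
by exists v; split=> //; exact: E_trans wz.
Qed.

Lemma rel_image_upset_eq x y : E x y ->
  rel_image E (upset [set x]) = rel_image E (upset [set y]).
Proof.
by move=> xy; apply/seteqP; split; apply: rel_image_upset_sub => //; exact: E_sym.
Qed.

(* Compactness makes E commute with the filtered intersection
   [x) = \bigcap U over the clopen increasing U containing x. *)
Lemma closed_rel_image_upset x : closed (rel_image E (upset [set x])).
Proof.
have -> : rel_image E (upset [set x]) =
    \bigcap_(U in [set U | clopen_increasing U /\ U x]) rel_image E U.
  apply/seteqP; split=> [z /rel_image_upsetE[w [xw wz]] U [[_ iU] Ux]|z zU].
    by exists w; split=> //; exact: iU xw.
  apply: contrapT => nz.
  have [y /rel_image1E zy xy|U [DU Ux] zU0] :=
      closed_disjoint_above pX (K := rel_image E [set z]) (x := x) (closed_class (x := z)).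
    by apply: nz; apply/rel_image_upsetE; exists y; split=> //; exact: E_sym.
  have [w [Uw wz]] := zU U (conj DU Ux).
  by apply: (zU0 w) => //; apply/rel_image1E; exact: E_sym.
by apply: closed_bigI => U [DU _]; case: (q_image mqE DU) => -[].
Qed.

Lemma maxs_class_above x y : E x y ->
  exists2 m, maxs (rel_image E [set x]) m & y <= m.
Proof.
by move=> xy; apply: closed_above_max => //; [exact: closed_class|exact/rel_image1E].
Qed.

Lemma mins_class_below x z : rel_image E (upset [set x]) z ->
  exists2 m, mins (rel_image E (upset [set x])) m & m <= z.
Proof. by apply: closed_below_min => //; exact: closed_rel_image_upset. Qed.

Lemma closed_id_saturated_S_closure Y :
  closed_id_saturated E (S_closure E Y).
Proof.
split; first by apply: closed_bigI => Z [[]].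
by move=> y Yy z yz Z [cZ YZ]; apply: (cZ.2 y) => //; exact: Yy.
Qed.

(** Since [x] itself may lie outside [S_closure_max E x], saturation is applied at a maximal element
    [m] of its class, where E([m)) = E([x)). *)
Lemma mins_S_closure_max x :
  mins (rel_image E (upset [set x])) `<=` S_closure_max E x.
Proof.
move=> z; have [m mx _] := maxs_class_above (E_refl x).
have xm : E x m by apply/rel_image1E; case: mx.
rewrite (rel_image_upset_eq xm) => zm.
have [_ sat] := closed_id_saturated_S_closure (maxs (rel_image E [set x])).
apply: (sat m); last by left.
exact: sub_gen_smallest.
Qed.

Lemma S_closure_max_sub Y x : closed_id_saturated E Y ->
  maxs (rel_image E [set x]) `<=` Y -> S_closure_max E x `<=` Y.
Proof. by move=> cY xY; exact: smallest_sub. Qed.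

Lemma S_closure_max_saturated Y x : closed_id_saturated E Y -> Y x ->
  S_closure_max E x `<=` Y.
Proof.
move=> cY Yx; apply: S_closure_max_sub => // z zx.
by apply: (cY.2 x) => //; right.
Qed.

Lemma maxs_S_closure_max x : maxs (rel_image E [set x]) `<=` S_closure_max E x.
Proof. exact: sub_gen_smallest. Qed.

Lemma S_closure_max_neq0 x : S_closure_max E x !=set0.
Proof.
have [m mx _] := maxs_class_above (E_refl x).
by exists m; exact: maxs_S_closure_max.
Qed.

(** * Congruences induced by closed id-saturated sets *)

Local Notation L := (dual_algebra mqE).
Implicit Types (U V W : DX X) (theta : L -> L -> Prop).

Lemma DX_ext U V : (forall x, \val U x <-> \val V x) -> U = V.
Proof.
by move=> UV; apply: val_inj; apply/seteqP; split=> x /UV.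
Qed.

Definition agree_on Y U V : Prop := forall x, Y x -> (\val U x <-> \val V x).

(** As [U] is increasing, [y] lies in E(U) iff [U] meets max E(y), and [y] lies outside the triangle
    of [U] iff some point of min E([y)) is outside [U]. Saturation keeps these test points in
    [Y]. *)
Lemma agree_on_congruence Y : id_saturated E Y -> @congruence L (agree_on Y).
Proof.
move=> sY.
have nab U V : agree_on Y U V -> forall y, Y y ->
    rel_image E (\val U) y -> rel_image E (\val V) y.
  move=> UV y Yy [u [Uu uy]].
  have [m my um] := maxs_class_above (E_sym uy).
  have ym : E y m by apply/rel_image1E; case: my.
  exists m; split; last exact: E_sym.
  apply/UV; first by apply: (sY y) => //; right.
  by have [_ iU] := DXP U; exact: iU um.
have tri U V : agree_on Y U V -> forall y, Y y ->
    down (rel_image E (~` \val U)) y -> down (rel_image E (~` \val V)) y.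
  move=> UV y Yy [w [[v [nUv vw]] yw]].
  have [|m my mv] := @mins_class_below y v.
    by apply/rel_image_upsetE; exists w; split=> //; exact: E_sym.
  have /rel_image_upsetE[p [yp pm]] := my.1.
  exists p; split=> //; exists m; split; last exact: E_sym.
  move=> Vm; apply: nUv; have [_ iU] := DXP U; apply: iU mv.
  by apply/UV => //; apply: (sY y) => //; left.
have sym U V : agree_on Y U V -> agree_on Y V U 
  by move=> UV x Yx; exact: iff_sym (UV x Yx).
split.
- split=> [U x //|//|U V W UV VW x Yx].
  exact: iff_trans (UV _ Yx) (VW _ Yx).
- by move=> U V U' V' UV UV' x Yx; split=> -[] /(UV _ Yx) ? /(UV' _ Yx) ?.
- move=> U V U' V' UV UV' x Yx; split=> -[].
  + by move/(UV _ Yx); left.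
  + by move/(UV' _ Yx); right.
  + by move/(UV _ Yx); left.
  + by move/(UV' _ Yx); right.
- move=> U V UV x Yx; split=> nx.
    by move/(tri _ _ (sym _ _ UV) _ Yx).
  by move/(tri _ _ UV _ Yx).
- by move=> U V UV x Yx; split; apply: nab => //; exact: sym.
Qed.

(** For [x] in [Z] but not in [Y], [closed_separation] yields [U] and [V] such that [U] and its
    intersection with [V] agree on [Y] but not at [x]. *)
Lemma agree_on_subset Y Z : closed Y ->
  (forall U V, agree_on Y U V -> agree_on Z U V) -> Z `<=` Y.
Proof.
move=> cY YZ x Zx; apply: contrapT => nYx.
have [U [V [DU DV Ux nVx UV]]] := closed_separation pX cY nYx.
have /YZ/(_ x Zx) : agree_on Y (mkDX DU) (mkDX (clopen_increasingI DU DV)).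
  by move=> y Yy; split=> /= [Uy|[]//]; split=> //; exact: UV.
by case=> /= /(_ Ux)[].
Qed.

(** Consists of the points whose prime filter of clopen increasing sets is a union of
    [theta]-classes. *)
Definition congruence_support theta : set X :=
  [set x | forall U V, theta U V -> (\val U x <-> \val V x)].

(** * The closed id-saturated set attached to a congruence *)

Section Support.
Variable theta : L -> L -> Prop.
Hypothesis ctheta : congruence theta.

Lemma cong_refl U : theta U U.
Proof. by have [r _ _] := cong_equiv ctheta; exact: r. Qed.

Lemma cong_sym U V : theta U V -> theta V U.
Proof. by have [_ s _] := cong_equiv ctheta; exact: s. Qed.

Lemma cong_trans U V W : theta U V -> theta V W -> theta U W.
Proof. by have [_ _ t] := cong_equiv ctheta; exact: t. Qed.

Lemma support_sep x : ~ congruence_support theta x ->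
  exists U V, [/\ theta U V, \val U x & ~ \val V x].
Proof.
move=> nx; apply: contrapT => nex; apply: nx => U V UV.
split=> h; apply: contrapT => nh; apply: nex.
  by exists U, V.
by exists V, U; split=> //; exact: cong_sym.
Qed.

Lemma closed_support : closed (congruence_support theta).
Proof.
have -> : congruence_support theta =
   \bigcap_(p in [set p : DX X * DX X | theta p.1 p.2])
     (~` \val p.1 `|` \val p.2).
  apply/seteqP; split=> x.
    move=> xs [U V] /= /xs UV.
    by have [/UV|] := pselect (\val U x); [right|left].
  move=> xs; apply: contrapT => /support_sep[U [V [UV Ux nVx]]].
  by have [|] := xs (U, V) UV.
apply: closed_bigI => -[U V] /= _; apply: closedU.
  by apply: open_closedC; case: (DXP U) => -[].
by case: (DXP V) => -[].
Qed.

(** Inclusion up to [S] implies inclusion modulo [theta]. The set [S] is arbitrary, so that unions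
    of differences are allowed. *)
Let collapses (S : set X) :=
  forall U V, \val U `\` \val V `<=` S -> theta (mmeet (U : L) V) U.

(* Quantifying over S makes nullity stable under finite unions. *)
Let null (N : set X) :=
  open N /\ forall S, collapses S -> collapses (N `|` S).

(** Modulo [theta], with juxtaposition for meet: U = U(V + U1) = UV + UU1 = UV + UV1 = UV + UV1V =
    UV. The first and fourth equalities hold because the differences concerned lie in [S]. *)
Let collapses_diff U1 V1 S : theta U1 V1 -> collapses S ->
  collapses ((\val U1 `\` \val V1) `|` S).
Proof.
move=> UV1 cS U V UVS.
have h1 : theta (mmeet (mmeet (U : L) V1) V) (mmeet (U : L) V1).
  apply: cS => x /= [[Ux V1x] nVx].
  by have [|[]|] := UVS x.
have h2 : theta (mmeet (U : L) (mjoin (V : L) U1)) U.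
  apply: cS => x /= [Ux nVU1].
  have [|[U1x _]|//] := UVS x; last by case: nVU1; right.
  by split=> // Vx; apply: nVU1; left.
have h3 : theta (mjoin (mmeet (U : L) V) (mmeet (U : L) U1))
                (mjoin (mmeet (U : L) V) (mmeet (U : L) V1)).
  by do 2 ?[apply: cong_join|apply: cong_meet] => //; exact: cong_refl.
have h4 := cong_join ctheta (cong_refl (mmeet (U : L) V)) (cong_sym h1).
have distr : mmeet (U : L) (mjoin (V : L) U1) =
             mjoin (mmeet (U : L) V) (mmeet (U : L) U1).
  apply: DX_ext => x /=; split=> [[Ux [?|?]]|[[]|[]]]; by
    [left|right|split=> //; left|split=> //; right].
have absorb : mjoin (mmeet (U : L) V) (mmeet (mmeet (U : L) V1) V) =
              mmeet (U : L) V.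
  by apply: DX_ext => x /=; split=> [[//|[[]]//]|]; left.
rewrite distr in h2; rewrite absorb in h4.
apply: cong_sym; apply: cong_trans (cong_sym h2) _.
exact: cong_trans h3 h4.
Qed.

(** Every point of [U \ V] is outside the support, hence in an open null set [U1 \ V1]. Null sets
    being stable under union, compactness covers [U \ V] by a single one, which is then used with
    [S] empty. *)
Lemma agree_on_support_diff U V :
  (forall x, congruence_support theta x -> \val U x -> \val V x) ->
  theta (mmeet (U : L) V) U.
Proof.
move=> UV.
have [||N N'|x|N [_ cN] N0] := compact_directed_empty (priestley_compact pX)
   (D := null) (f := fun N => (\val U `\` \val V) `\` N).
- by exists set0; split; [exact: open0|move=> S; rewrite set0U].
- move=> N [oN _]; apply: closed_setD => //; apply: closed_setD.
    by case: (DXP U) => -[].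
  by case: (DXP V) => -[].
- move=> [oN cN] [oN' cN']; exists (N `|` N').
    split; first exact: openU.
    by move=> S /cN'/cN; rewrite setUA.
  by move=> x [UVx nN]; split; split=> // ?; apply: nN; [left|right].
- have [xs|/support_sep[U1 [V1 [UV1 U1x nV1x]]]] :=
      pselect (congruence_support theta x).
    exists set0; first by split; [exact: open0|move=> S; rewrite set0U].
    by move=> [[Ux nVx] _]; apply: nVx; exact: UV.
  exists (\val U1 `\` \val V1); last by move=> [_]; apply.
  split; last by move=> S; exact: collapses_diff.
  apply: open_setD; first by case: (DXP U1) => -[].
  by case: (DXP V1) => -[].
apply: (cN set0) => [U' V' UV'|x UVx].
  suff -> : mmeet (U' : L) V' = U' by exact: cong_refl.
  apply: DX_ext => x /=; split=> [[]//|U'x]; split=> //.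
  by apply: contrapT => nV'x; case: (UV' x).
by left; apply: contrapT => nNx; apply: (N0 x).
Qed.

Lemma agree_on_support U V :
  agree_on (congruence_support theta) U V <-> theta U V.
Proof.
split=> [UV|UV x]; last exact.
have h1 := @agree_on_support_diff U V (fun x xs => (UV x xs).1).
have h2 := @agree_on_support_diff V U (fun x xs => (UV x xs).2).
apply: cong_trans (cong_sym h1) _.
suff -> : mmeet (U : L) V = mmeet (V : L) U by [].
by apply: DX_ext => x /=; split=> -[].
Qed.

Lemma id_saturated_support : id_saturated E (congruence_support theta).
Proof.
move=> y ys z yz; apply: contrapT => /support_sep[U [V [UV Uz nVz]]].
case: yz => [[zy zmin]|[/rel_image1E yz zmax]].
(* By minimality of [z], no point of E([y)) outside [U] is below [z], so some [W] contains all these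
   points but not [z]. Then the triangle of the join of [U] and [W] contains [y], while that of the
   join of [V] and [W] does not. *)
- have [||W [DW nWz KW]] := closed_disjoint_below pX (x := z)
      (K := rel_image E (upset [set y]) `\` \val U).
  + apply: closed_setD; first exact: closed_rel_image_upset.
    by case: (DXP U) => -[].
  + by move=> x [xy nUx] xz; apply: nUx; rewrite (zmin x).
  pose W' : L := mkDX DW.
  have := cong_triangle ctheta (cong_join ctheta UV (cong_refl W')).
  move=> /(ys _ _)[/= h _]; apply: h.
    move=> [w [[v [nUWv vw]] yw]]; apply: nUWv.
    have [Uv|nUv] := pselect (\val U v); [by left|right].
    apply: KW; split=> //; apply/rel_image_upsetE.
    by exists w; split=> //; exact: E_sym.
  have /rel_image_upsetE[w [yw wz]] := zy.
  exists w; split=> //; exists z; split; last exact: E_sym.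
  by case.
(* Dually, [W] contains [z] and misses the points of E(y) in [V]: meeting with [W] and applying
   nabla separates [U] from [V] at [y]. *)
- have [||W [DW Wz KW]] := closed_disjoint_above pX (x := z)
      (K := rel_image E [set y] `&` \val V).
  + apply: closedI; first exact: closed_class.
    by case: (DXP V) => -[].
  + by move=> x [yx Vx] zx; apply: nVz; rewrite -(zmax x).
  pose W' : L := mkDX DW.
  have := cong_nabla ctheta (cong_meet ctheta UV (cong_refl W')).
  move=> /(ys _ _)[/= h _].
  have [|w [[Vw Ww] wy]] := h; first by exists z; split=> //; exact: E_sym.
  by apply: (KW w) => //; split=> //; apply/rel_image1E; exact: E_sym.
Qed.

Lemma closed_id_saturated_support :
  closed_id_saturated E (congruence_support theta).
Proof. by split; [exact: closed_support|exact: id_saturated_support]. Qed.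

Lemma support_neqT :
  non_identity theta <-> congruence_support theta <> [set: X].
Proof.
split=> [[U [V [UV neq]]] sT|nT].
  by apply: neq; apply: DX_ext => x; apply/(agree_on_support U V).2 => //; rewrite sT.
apply: contrapT => nid; apply: nT; apply/seteqP; split=> // x _ U V UV.
by suff -> : U = V by []; apply: contrapT => neq; apply: nid; exists U, V.
Qed.

End Support.

(** Otherwise agreement on [Y] would imply agreement on all of [X], and [agree_on_subset] would give
    [Y] = [X]. *)
Lemma agree_on_non_identity Y : closed Y -> Y <> [set: X] ->
  @non_identity L (agree_on Y).
Proof.
move=> cY nT; apply: contrapT => nid; apply: nT; apply/seteqP; split=> //.
apply: agree_on_subset => // U V UV x _.
by suff -> : U = V by []; apply: contrapT => neq; apply: nid; exists U, V.
Qed.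

(** * Subdirect irreducibility and simplicity in terms of saturated sets *)

Definition greatest_proper (M : set X) :=
  [/\ closed_id_saturated E M, M <> [set: X] &
    forall Y, closed_id_saturated E Y -> Y <> [set: X] -> Y `<=` M].

Lemma subdirectly_irreducibleP :
  subdirectly_irreducible L <-> exists M, greatest_proper M.
Proof.
split=> [[theta [ct nt tmin]]|[M [cM nM Mmax]]].
  exists (congruence_support theta); split.
  - exact: closed_id_saturated_support.
  - exact/support_neqT.
  move=> Y cY nY; apply: agree_on_subset => [|U V]; first exact: closed_support.
  move=> /(agree_on_support ct); apply: tmin => //.
    exact: agree_on_congruence cY.2.
  exact: agree_on_non_identity cY.1 nY.
exists (agree_on M); split.
- exact: agree_on_congruence cM.2.
- exact: agree_on_non_identity cM.1 nM.
move=> theta ct nt U V UV; apply/agree_on_support => // x xs.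
apply: UV; apply: Mmax xs; first exact: closed_id_saturated_support.
exact/support_neqT.
Qed.

Lemma greatest_proper_simple M : greatest_proper M ->
  simple_algebra L <-> M = set0.
Proof.
move=> [cM nM Mmax].
(* These two elements disagree at every point, so a single point of [M] keeps [agree_on M] from
   being total. *)
pose top : L := mkDX (clopen_increasingT X).
pose bot : L := mkDX (clopen_increasing0 X).
split=> [[_ sL]|M0].
  apply/seteqP; split=> // x Mx.
  have [id|tot] := sL _ (agree_on_congruence cM.2).
    by have [U [V [/id]]] := agree_on_non_identity cM.1 nM.
  by have [/(_ I)] := tot top bot x Mx.
split.
  exists top, bot => tb; apply: nM; apply/seteqP; split=> // x _.
  have : \val top x by [].
  by rewrite tb.
move=> theta ct.
have [sT|nT] := pselect (congruence_support theta = [set: X]).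
  left=> U V; split=> [UV|->]; last exact: cong_refl.
  apply: contrapT => neq.
  by have /(support_neqT ct) : non_identity theta by exists U, V.
right=> U V; apply/agree_on_support => // x xs.
by have := Mmax _ (closed_id_saturated_support ct) nT _ xs; rewrite M0.
Qed.

Lemma SI_not_simpleP :
  subdirectly_irreducible L /\ ~ simple_algebra L <->
  exists2 M, greatest_proper M & M !=set0.
Proof.
split=> [[/subdirectly_irreducibleP[M gM] ns]|[M gM [x Mx]]].
  exists M => //; apply: contrapT => M0; apply: ns.
  apply/(greatest_proper_simple gM); apply/seteqP; split=> // x Mx.
  by apply: M0; exists x.
split; first by apply/subdirectly_irreducibleP; exists M.
by move/(greatest_proper_simple gM) => M0; rewrite M0 in Mx.
Qed.

Lemma closed_id_saturated_S_closure_maxU1 x :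
  closed_id_saturated E (S_closure_max E x `|` [set x]).
Proof.
have [cC sC] := closed_id_saturated_S_closure (maxs (rel_image E [set x])).
split; first by apply: closedU => //; exact: closed_singleton.
move=> y [Cy|->] z yz; left; first exact: sC yz.
by case: yz => [/mins_S_closure_max|/maxs_S_closure_max].
Qed.

End MqSpaces.

(** * The alternatives (a) and (b) *)

Theorem theorem2p5 (d : Order.disp_t) (X : POrderedTopological.type d)
    (E : X -> X -> Prop) (mqE : mq_space E) :
  let A : set X := [set x | S_closure_max E x = [set: X]] in
  let a := [/\ A <> [set: X], A !=set0 & open A] in
  let b := exists x : X, ~ S_closure_max E x x /\
                         [set: X] = S_closure_max E x `|` [set x] in
  (subdirectly_irreducible (dual_algebra mqE) /\
   ~ simple_algebra (dual_algebra mqE)) <->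
  ((a /\ ~ b) \/ (~ a /\ b)).
Proof.
move=> A a b.
have cS x : closed_id_saturated E (S_closure_max E x).
  exact: closed_id_saturated_S_closure.
(* A point [y] of [A] is in C(x) or equals [x]; either way C(x) is all of [X], against [x] being
   outside C(x). *)
have nab : a -> ~ b.
  move=> [_ [y Ay] _] [x [nCx XC]].
  have : (S_closure_max E x `|` [set x]) y by rewrite -XC.
  case=> [Cy|yx]; apply: nCx; last by rewrite -yx Ay.
  by apply: (S_closure_max_saturated (cS x) Cy); rewrite Ay.
suff key : (exists2 M, greatest_proper E M & M !=set0) <-> a \/ b.
  apply: iff_trans (SI_not_simpleP mqE) _; apply: iff_trans key _.
  split=> [[ha|hb]|[[ha _]|[_ hb]]]; [left|right|by left|by right].
    by split=> //; exact: nab.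
  by split=> // /nab.
split=> [[M [cM nM Mmax] [m Mm]]|[[nA [x Ax] oA]|[x [nCx XC]]]].
(* A saturated closed set meeting [A] contains some C(x) equal to [X], so the proper set [M] misses
   [A]. *)
- have AM x : A x -> ~ M x.
    move=> Ax Mx; apply: nM; apply/seteqP; split=> // y _.
    by apply: (S_closure_max_saturated cM Mx); rewrite Ax.
  have [MA|] := pselect (~` M `<=` A).
    left; rewrite /a; have -> : A = ~` M by apply/seteqP; split.
    split; last by apply: closed_openC; case: cM.
      by move=> MT; have : (~` M) m by rewrite MT.
    apply: contrapT => M0; apply: nM; apply/seteqP; split=> // y _.
    by apply: contrapT => nMy; apply: M0; exists y.
  move=> /existsNP[x /not_implyP[nMx nAx]]; right; exists x.
  have CM := Mmax _ (cS x) nAx.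
  split; first by move/CM.
  apply: contrapT => CT; apply: nMx.
  apply: (Mmax _ (closed_id_saturated_S_closure_maxU1 mqE x)); last by right.
  by move=> /esym.
- exists (~` A).
    split; first split; first exact: open_closedC.
    (* The complement of [A] is saturated: [z] lies in C(y), so C(z) is contained in C(y), and C(z)
       = [X] would put [y] in [A]. *)
    + move=> y nAy z yz Az; apply: nAy.
      apply/seteqP; split=> // u _.
      suff zy : S_closure_max E z `<=` S_closure_max E y by apply: zy; rewrite Az.
      apply: S_closure_max_saturated => //.
      by case: yz => [/(mins_S_closure_max mqE)|/maxs_S_closure_max].
    + by move=> AT; have : (~` A) x by rewrite AT.
    move=> Y cY nY y Yy Ay; apply: nY; apply/seteqP; split=> // u _.
    by apply: (S_closure_max_saturated cY Yy); rewrite Ay.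
  apply: contrapT => A0; apply: nA; apply/seteqP; split=> // y _.
  by apply: contrapT => nAy; apply: A0; exists y.
- exists (S_closure_max E x); last exact: S_closure_max_neq0.
  split=> //; first by move=> CT; apply: nCx; rewrite CT.
  move=> Y cY nY y Yy.
  have : (S_closure_max E x `|` [set x]) y by rewrite -XC.
  (* A point of [Y] outside C(x) can only be [x]; then [Y] contains both C(x) and [x], hence all of
     [X]. *)
  case=> // yx; case: nY; apply/seteqP; split=> // u _.
  have : (S_closure_max E x `|` [set x]) u by rewrite -XC.
  rewrite yx in Yy.
  by case=> [|->//]; exact: S_closure_max_saturated.
Qed.
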